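(* For any integer $\ell\geq 2$ and any real number $\varepsilon>0$, there exists an integer $\delta_{(\ell,\varepsilon)}$ such that for every graph $G=(V,E)$ with minimum degree $\delta\geq\delta_{(\ell,\varepsilon)}$, each tolerance function $\alpha:C\to(0,1)$ and every $\varepsilon$-excessive list assignment $L:E\to 2^C$ of $G$ such that $|L(e)|\leq \ell$ for every edge $e$ of $G$, there is an $\alpha$-majority $L$-colouring of $G$. It is sufficient to let $\delta_{(\ell,\varepsilon)}=2\left\lceil\frac{\ell}{\varepsilon}\right\rceil^2-2\left\lceil\frac{\ell}{\varepsilon}\right\rceil$.
   Context: A graph means a finite simple graph; $d(v)$ is the degree of $v$ in $G$. Let $C$ be a set of colours. A list assignment is a function $L:E\to 2^C$; a tolerance function is any function $\alpha:C\to(0,1)$. The list assignment $L$ (with tolerance function $\alpha$) is called $\varepsilon$-excessive if $\sum_{c\in L(e)}\alpha(c)\geq 1+\varepsilon$ for every edge $e\in E$. An $\alpha$-majority $L$-colouring of $G$ is a (not necessarily proper) edge colouring $\omega:E\to C$ such that $\omega(e)\in L(e)$ for every $e\in E$ and, for every vertex $v\in V$ and every colour $c\in C$, the number of edges incident with $v$ that are coloured $c$ by $\omega$ is at most $\alpha(c)d(v)$. *)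

(* Defs.v *)
From HB Require Import structures.
From mathcomp Require Import all_boot all_order all_algebra.
From mathcomp Require Import boolp classical_sets functions cardinality.
From mathcomp Require Import reals ereal esum.

Set Implicit Arguments.
Unset Strict Implicit.
Unset Printing Implicit Defensive.

Import Order.TTheory GRing.Theory Num.Theory.
Local Open Scope ring_scope.

Record sgraph := SGraph {
  vertex :> finType;
  edges : {set {set vertex}};
  card_edges : forall x, x \in edges -> #|x| = 2%N }.

(* Lists and colourings have domain exactly E, so that an edgeless graph has
   the empty colouring even when there are no colours. *)
Definition edge (G : sgraph) : finType := {x : {set G} | x \in edges G}.

Definition incident (G : sgraph) (v : G) (x : edge G) : bool := v \in val x.

Definition degree (G : sgraph) (v : G) : nat :=
  #|[set x : edge G | incident v x]|.

(* The default #|G| exceeds every degree, hence does not affect the minimum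
   when there is a vertex; the graph without vertices gets the value 0. *)
Definition min_degree (G : sgraph) : nat :=
  \big[minn/#|G|]_(v : G) degree v.

Section Majority.
Variables (R : realType) (G : sgraph) (C : choiceType).

Definition tolerance (alpha : C -> R) : Prop :=
  forall c, 0 < alpha c < 1.

(* Lists are arbitrary, possibly infinite, sets of colours; [esum] is the
   supremum of the sums over finite subsets, which is the sum of the list
   because the tolerances are positive. *)
Definition excessive (eps : R) (alpha : C -> R) (L : edge G -> set C) : Prop :=
  forall x : edge G,
    ((1 + eps)%:E <= \esum_(c in L x) (alpha c)%:E)%E.

Definition lists_of_size_at_most (l : nat) (L : edge G -> set C) : Prop :=
  forall x : edge G, (L x #<= `I_l)%card.

Definition majority_colouring (alpha : C -> R) (L : edge G -> set C)
    (w : edge G -> C) : Prop :=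
  (forall x : edge G, L x (w x)) /\
  (forall (v : G) (c : C),
    #|[set x : edge G | incident v x & w x == c]|%:R
      <= alpha c * (degree v)%:R).

End Majority.

Definition sufficient_min_degree (R : realType) (l : nat) (eps : R) (d0 : int)
    : Prop :=
  forall G : sgraph, d0 <= (min_degree G)%:Z ->
  forall (C : choiceType) (alpha : C -> R), tolerance alpha ->
  forall L : edge G -> set C,
    excessive eps alpha L -> lists_of_size_at_most l L ->
  exists w : edge G -> C, majority_colouring alpha L w.

(* Main.v *)
Require Import Defs.
From mathcomp Require Import all_boot all_order all_algebra.
From mathcomp Require Import zify ring lra.
Import Order.TTheory GRing.Theory Num.Theory.
Local Open Scope ring_scope.

(** Put k = ceil (l / eps) and let beta c be the positive part of
    alpha c - 1/k. A list has at most l colours and l / k <= eps, so beta sums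
    to at least 1 over each list; dividing by that sum gives every edge
    weights on its list that sum to 1 and are bounded by beta. This fractional
    colouring puts at most beta c * d(v) of the colour c at v, which is below
    the allowed alpha c * d(v) by d(v) / k whenever c is used at all. Hence a
    rounding with additive error at most d(v) / k suffices, and the bound on
    the minimum degree says that d(v) / k >= 2 (k - 1).

    For k >= 3 the error 4 is affordable. It is achieved by iterated rounding
    ([iterated_rounding]): as long as some weights are fractional, ignore the
    vertex-colour pairs that see at most four fractional weights. Each weight
    occurs in two pairs and each edge with a fractional weight has at least
    two of them, so the remaining linear constraints are fewer than the
    fractional weights. One can therefore move along a line on which these
    constraints stay satisfied until a weight becomes 0 or 1. A pair which has
    been ignored gains less than 1 for each of its at most four weights.

    If there is an edge, then k >= 2, because the tolerances are below 1. For
    k = 2 only d(v) >= 4 is known and the rounding error is too large. But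
    then each list has at least three colours with alpha c > 1/2, and it is
    enough to use each of these on at most half of the edges at each vertex
    ([half_majority_colouring]). Orient the graph so that in- and outdegrees
    differ by at most 1 everywhere ([balanced_orientation]). Regard every
    vertex as two, one for the outgoing and one for the incoming edges, so
    that the graph becomes bipartite, and split these further into vertices of
    degree at most 3. By Galvin's theorem
    ([bipartite_list_edge_colouring]) the resulting bipartite graph has a
    proper edge colouring from lists of size 3, so that a colour occurs at v
    at most ceil (d+ / 3) + ceil (d- / 3) times, which is at most d(v) / 2
    when d(v) >= 4. *)

(** * Iterated rounding *)

Lemma exists_null_vector {R : fieldType} {X J : finType} (F : {set X}) (Q : {set J})
    (A : X -> J -> R) :
  (#|Q| < #|F|)%N ->
  exists z : X -> R, [/\ forall x, x \notin F -> z x = 0,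
    exists x, z x != 0 & forall j, j \in Q -> \sum_x z x * A x j = 0].
Proof.
move=> ltQF.
(* The rows of M are indexed by F: a left null vector of M, extended by 0
   outside F, is what is wanted, and M has fewer columns than rows. *)
pose M := \matrix_(i < #|F|, j < #|Q|) A (enum_val i) (enum_val j).
pose v := nz_row (kermx M).
have v0 : v != 0.
  rewrite nz_row_eq0 -mxrank_eq0 mxrank_ker subn_eq0 -ltnNge.
  exact: leq_ltn_trans (rank_leq_col M) ltQF.
have vM : v *m M = 0 by apply/sub_kermxP; apply: nz_row_sub.
pose z x := \sum_(i < #|F|) if enum_val i == x then v 0 i else 0.
have zE i : z (enum_val i) = v 0 i.
  rewrite /z (bigD1 i) //= eqxx big1 ?addr0 // => j ji.
  by rewrite (inj_eq enum_val_inj) (negPf ji).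
exists z; split.
- move=> x xF; apply: big1 => i _; case: eqP => // ix.
  by rewrite -ix enum_valP in xF.
- case/rV0Pn: v0 => i vi; exists (enum_val i); by rewrite zE.
move=> j jQ; have := congr1 (fun B : 'rV_#|Q| => B 0 (enum_rank_in jQ j)) vM.
rewrite !mxE => sum0; rewrite -[RHS]sum0.
transitivity (\sum_x \sum_(i < #|F|)
    if enum_val i == x then v 0 i * A (enum_val i) j else 0).
  apply: eq_bigr => x _; rewrite /z mulr_suml; apply: eq_bigr => i _.
  by case: eqP => [->|]; rewrite ?mul0r.
rewrite exchange_big; apply: eq_bigr => i _ /=.
rewrite mxE enum_rankK_in // (bigD1 (enum_val i)) //= eqxx big1 ?addr0 // => x nx.
by rewrite eq_sym (negPf nx).
Qed.

(** The point x lies in the unit cube and the line in direction z leaves it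
    through a proper face: [room i] is the distance one can go along z before
    the coordinate i reaches 0 or 1, and the least one is the step to take. *)
Lemma move_to_face {R : realFieldType} {X : finType} (x z : X -> R) :
  (forall i, 0 <= x i <= 1) ->
  (forall i, z i != 0 -> 0 < x i < 1) ->
  (exists i, z i != 0) ->
  exists2 m : R, forall i, 0 <= x i + m * z i <= 1 &
    exists2 i, z i != 0 & x i + m * z i = 0 \/ x i + m * z i = 1.
Proof.
move=> x01 zF [i0 zi0].
pose room i := (if 0 < z i then 1 - x i else - x i) / z i.
have room_gt0 i : z i != 0 -> 0 < room i.
  move=> zi; have /andP[x0 x1] := zF i zi; rewrite /room; case: (ltP 0 (z i)) => zi0'.
    by rewrite divr_gt0 // subr_gt0.
  by rewrite nmulr_lgt0 ?oppr_lt0 // invr_lt0 lt_neqAle zi.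
have roomE i : z i != 0 -> room i * z i = if 0 < z i then 1 - x i else - x i.
  by move=> zi; rewrite divfK.
have [i zi imin] := @arg_minP _ R X i0 (fun i => z i != 0) room zi0.
exists (room i); last first.
  by exists i; rewrite // roomE //; case: ifP => _; [right | left]; rewrite ?subrKC ?subrr.
move=> j; have [->|zj] := eqVneq (z j) 0; first by rewrite mulr0 addr0.
have le := imin j zj; have := roomE j zj; have := room_gt0 i zi.
have /andP[? ?] := zF j zj; case: (ltP 0 (z j)) => zj0 r0 rj.
  have : room i * z j <= room j * z j by rewrite ler_pM2r.
  have := mulr_gt0 r0 zj0; lra.
have : room j * z j <= room i * z j by rewrite ler_wnM2r.
have : room i * z j <= 0 by rewrite mulr_ge0_le0 // ltW.
lra.
Qed.

Section Rounding.
Context {R : realFieldType} {X E Y : finType}.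
Variables (block : X -> E) (inc : X -> {set Y}) (t : nat) (b : Y -> R).

Definition fractional (x : X -> R) : {set X} := [set i | 0 < x i < 1].

(** The invariant of iterated rounding. The bound [b y] holds for the weights
    themselves, or else for the number of weights that may still become 1, up
    to the error 2t. The second alternative survives every further step since
    weights equal to 0 are never changed. *)
Definition roundable (x : X -> R) : Prop := [/\ forall i, 0 <= x i <= 1,
  forall e, \sum_(i | block i == e) x i = 1 &
  forall y, \sum_(i | y \in inc i) x i <= b y \/
            #|[set i | (y \in inc i) && (x i != 0)]|%:R <= b y + (2 * t)%:R].

Lemma integral_off_fractional x i : roundable x -> i \notin fractional x ->
  x i = (x i != 0)%:R.
Proof.
case=> x01 _ _; rewrite inE; have /andP[x0 x1] := x01 i.
rewrite !lt_neqAle x0 x1 !andbT negb_and !negbK [0 == _]eq_sym.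
by case: eqP => [->|_] //= /eqP ->.
Qed.

(** The weights of a block sum to an integer, so that a block cannot contain
    exactly one non-integral weight. *)
Lemma fractional_partner x i : roundable x -> i \in fractional x ->
  exists2 j, j \in fractional x & (block j == block i) && (j != i).
Proof.
move=> rx iF; have [_ sum1 _] := rx.
case: (boolP [exists j in fractional x, (block j == block i) && (j != i)]).
  by case/'exists_andP=> j [? ?]; exists j.
move=> noj; have := sum1 (block i); rewrite (bigD1 i) //=.
rewrite (eq_bigr (fun j => (x j != 0)%:R)) => [|j jP]; last first.
  apply: integral_off_fractional => //; apply: contraNN noj => jF.
  by apply/'exists_andP; exists j.
rewrite -natr_sum; move: iF; rewrite inE => /andP[x0 x1].
case: (\sum_(j | _) _)%N => [|n]; first lra.
rewrite -natr1; have := ler0n R n; lra.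
Qed.

(** The constraints to be kept in a rounding step: the sums of the blocks in
    [touched], and the loads of the sets in [crowded]. For a set outside
    [crowded], turning all of its fractional weights into 1 adds at most 2t. *)
Definition touched x : {set E} := block @: fractional x.
Definition crowded x : {set Y} :=
  [set y | 2 * t < #|[set i in fractional x | y \in inc i]|]%N.

(** Double counting. With f fractional weights there are at most f / 2 touched
    blocks by [fractional_partner], and at most t f / (2t + 1) crowded sets,
    because each weight lies in at most t sets; the latter is below f / 2. *)
Lemma few_active_constraints x : (forall i, #|inc i| <= t)%N -> roundable x ->
  fractional x != set0 -> (#|touched x| + #|crowded x| < #|fractional x|)%N.
Proof.
move=> inct rx; rewrite -card_gt0 => F0.
have tF : (#|touched x| * 2 <= #|fractional x|)%N.
  rewrite -sum_nat_const -sum1_card (partition_big_imset block) /=.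
  apply: leq_sum => _ /imsetP[i iF ->].
  have [j jF /andP[/eqP bj nji]] := fractional_partner x i rx iF.
  by rewrite (bigD1 i) ?iF ?eqxx //= (bigD1 j) ?jF ?bj ?eqxx.
have cF : (#|crowded x| * (2 * t).+1 <= #|fractional x| * t)%N.
  rewrite -!sum_nat_const.
  apply: (@leq_trans (\sum_(y in crowded x) \sum_(i in fractional x) (y \in inc i))).
    apply: leq_sum => y; rewrite inE => /leq_trans; apply.
    rewrite -sum1_card big_mkcond [leqRHS]big_mkcond /=; apply: leq_sum => i _.
    by rewrite inE; case: (i \in _); case: (y \in _).
  rewrite exchange_big; apply: leq_sum => i _; apply: leq_trans (inct i).
  rewrite -sum1_card big_mkcond [leqRHS]big_mkcond /=; apply: leq_sum => y _.
  by case: (y \in crowded _); case: (y \in _).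
nia.
Qed.

(** There are fewer active constraints than fractional weights, so the
    homogeneous system has a nonzero solution supported on the fractional
    weights. Moving along it keeps the active constraints, and
    [move_to_face] makes a fractional weight integral. *)
Lemma rounding_step x : (forall i, #|inc i| <= t)%N -> roundable x ->
  fractional x != set0 -> exists x', [/\ roundable x',
    forall i, x i = 0 -> x' i = 0 & fractional x' \proper fractional x].
Proof.
move=> inct rx F0; have [x01 sum1 load] := rx.
pose Q := [set j : E + Y | match j with inl e => e \in touched x
                                      | inr y => y \in crowded x end].
pose A i (j : E + Y) : R := match j with inl e => (block i == e)%:R
                                   | inr y => (y \in inc i)%:R end.
have [|z [z0 znz zQ]] := exists_null_vector (fractional x) Q A.
  apply: leq_ltn_trans (few_active_constraints x inct rx F0).
  have -> : Q = inl @: touched x :|: inr @: crowded x.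
    apply/setP => -[e|y]; rewrite in_setU [LHS]inE mem_imset; try by move=> ? ? [].
      by case: (e \in _) => //=; apply/esym/imsetP => -[].
    by rewrite orbC; case: (y \in _) => //=; apply/esym/imsetP => -[].
  by apply: leq_trans (leq_card_setU _ _) _; rewrite leq_add ?leq_imset_card.
have zF i : z i != 0 -> 0 < x i < 1.
  by move=> zi; apply: contraNT zi => iF; rewrite z0 // inE.
have [m x'01 [i0 zi0 face]] := move_to_face x z x01 zF znz.
exists (fun i => x i + m * z i).
have supp i : x i = 0 -> x i + m * z i = 0.
  by move=> xi; rewrite z0 ?mulr0 ?addr0 ?xi // inE xi ltxx.
have sumz (P : pred X) : \sum_(i | P i) z i = 0 ->
  \sum_(i | P i) (x i + m * z i) = \sum_(i | P i) x i.
  by move=> s0; rewrite big_split /= -mulr_sumr s0 mulr0 addr0.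
have zA (P : pred X) : \sum_i z i * (P i)%:R = \sum_(i | P i) z i.
  rewrite [RHS]big_mkcond; apply: eq_bigr => i _.
  by case: (P i); rewrite ?mulr1 ?mulr0.
split=> //.
- split=> // [e|y].
    rewrite sumz // -zA; have [eT|eT] := boolP (e \in touched x).
      by apply: (zQ (inl e)); rewrite inE.
    rewrite big1 // => i _; have [iF|/z0->] := boolP (i \in fractional x); last by rewrite mul0r.
    by case: eqP => [ie|]; [rewrite -ie imset_f in eT | rewrite mulr0].
  case: (load y) => loady; last first.
    right; apply: le_trans loady; rewrite ler_nat; apply: subset_leq_card.
    apply/subsetP => i; rewrite !inE => /andP[-> /=]; apply: contraNN => /eqP xi.
    by rewrite supp.
  have [yC|yC] := boolP (y \in crowded x).
    by left; rewrite sumz // -zA; apply: (zQ (inr y)); rewrite inE.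
  (* The set y leaves the reach of the linear constraints: its support
     consists of the weights equal to 1, which are bounded by the load, and of
     at most 2t fractional weights. *)
  right; rewrite inE -leqNgt in yC.
  pose I := [set i | (y \in inc i) && (x i == 1)].
  apply: (@le_trans _ _ (#|I|%:R + (2 * t)%:R)).
    rewrite -natrD ler_nat; apply: leq_trans (leq_add (leqnn _) yC).
    apply: leq_trans (leq_card_setU _ _); apply: subset_leq_card.
    apply/subsetP => i; rewrite !inE => /andP[-> /=].
    have /andP[x0 x1] := x01 i; rewrite !lt_neqAle x0 x1 !andbT.
    case: (x i =P 1) => //= _; rewrite andbT; apply: contraNneq => xi.
    by rewrite supp.
  rewrite lerD2r; apply: le_trans loady; rewrite -sum1_card natr_sum.
  rewrite big_mkcond [leRHS]big_mkcond; apply: ler_sum => i _ /=.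
  rewrite inE; case: (y \in inc i) => //=; case: eqP => [->|_] //.
  by have /andP[] := x01 i.
apply/properP; split.
  apply/subsetP => i; have [//|iF] := boolP (i \in fractional x).
  by rewrite inE z0 // mulr0 addr0; rewrite inE in iF; rewrite (negPf iF).
exists i0; first by rewrite inE zF.
by rewrite inE; case: face => ->; rewrite ltxx ?andbF.
Qed.

Lemma round_fractional x : (forall i, #|inc i| <= t)%N -> roundable x ->
  exists2 x', roundable x' /\ fractional x' = set0 & forall i, x i = 0 -> x' i = 0.
Proof.
move=> inct; have [n leFn] := ubnP #|fractional x|.
elim: n => // n IHn in x leFn * => rx.
have [F0|F0] := eqVneq (fractional x) set0; first by exists x.
have [x' [rx' s' F']] := rounding_step x inct rx F0.
have [|x'' ? s''] := IHn x' _ rx'; first exact: leq_trans (proper_card F') leFn.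
by exists x'' => // i /s'/s''.
Qed.

End Rounding.

(** A one-sided form of the theorem of Beck and Fiala, with the additional
    requirement that exactly one element of every block is selected. *)
Theorem iterated_rounding {R : realFieldType} {X E Y : finType}
    (block : X -> E) (inc : X -> {set Y}) (t : nat) (x : X -> R) :
  (forall i, #|inc i| <= t)%N -> (forall i, 0 <= x i) ->
  (forall e, \sum_(i | block i == e) x i = 1) ->
  exists w : E -> X, [/\ forall e, block (w e) = e, forall e, x (w e) != 0 &
    forall y, #|[set e | y \in inc (w e)]|%:R
              <= \sum_(i | y \in inc i) x i + (2 * t)%:R].
Proof.
move=> inct x0 sum1.
pose b y := \sum_(i | y \in inc i) x i.
have rx : roundable block inc t b x.
  split=> // [i|y]; last by left.
  rewrite x0 -(sum1 (block i)) (bigD1 i) //= lerDl; apply: sumr_ge0 => j _; exact: x0.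
have [x' [rx' F0] supp] := round_fractional _ _ _ _ x inct rx.
have int i : x' i = (x' i != 0)%:R.
  by apply: (integral_off_fractional _ _ _ _ _ _ rx'); rewrite F0 inE.
have [_ sum1' load'] := rx'.
have wP e : exists i, (block i == e) && (x' i != 0).
  apply/existsP; apply: contraT => /existsPn no; have := sum1' e; rewrite big1.
    by move/eqP; rewrite eq_sym oner_eq0.
  by move=> i ie; have := no i; rewrite ie => /negPn/eqP.
pose w e := xchoose (wP e).
have wE e : block (w e) = e /\ x' (w e) != 0.
  by have /andP[/eqP] := xchooseP (wP e).
exists w; split=> [e|e|y].
- exact: (wE e).1.
- by apply: contraNneq (wE e).2 => /supp->.
have count : (#|[set e | y \in inc (w e)]| <=
              #|[set i | (y \in inc i) && (x' i != 0%R)]|)%N.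
  have winj : injective w by move=> e f /(congr1 block); rewrite !(wE _).1.
  rewrite -(card_imset _ winj); apply: subset_leq_card; apply/subsetP => i.
  by case/imsetP=> e; rewrite inE => ye ->; rewrite inE ye (wE e).2.
case: (load' y) => load; last by apply: le_trans load; rewrite ler_nat.
apply: (@le_trans _ _ (b y)); last by rewrite lerDl ler0n.
apply: le_trans load; apply: le_trans (_ : #|[set i | (y \in inc i) && (x' i != 0)]|%:R <= _).
  by rewrite ler_nat.
rewrite -sum1_card natr_sum big_mkcond [leRHS]big_mkcond; apply: ler_sum => i _ /=.
by rewrite inE; case: (y \in inc i) => //=; rewrite [leRHS]int; case: (_ != 0).
Qed.

(** * Balanced orientations *)

(** The coefficient at v of the boundary of e, seen as a chain directed from
    b e to a e. *)
Definition boundary {E V : eqType} (a b : E -> V) (e : E) (v : V) : int :=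
  (a e == v)%:R - (b e == v)%:R.

Lemma boundary_at {E V : eqType} (a b : E -> V) (e : E) (v : V) :
  boundary a b e v != 0 ->
  exists (s : bool) (p : V),
    forall u, boundary a b e u = (-1) ^+ s * ((v == u)%:R - (p == u)%:R).
Proof.
rewrite /boundary; case: (a e =P v) => [<-|_].
  by move=> _; exists false, (b e) => u; rewrite mul1r.
case: (b e =P v) => [<- _|_]; last by rewrite subrr eqxx.
by exists true, (a e) => u; rewrite expr1 mulN1r opprB.
Qed.

(** The edges of a multigraph (loops are allowed) can be oriented so that in-
    and outdegree differ by at most 1 at every vertex. If two edges vp and vq
    that are not loops meet at v, replace them by a single edge pq and orient
    that one by induction; let the path from p to q through v follow its
    direction. When only loops meet other edges, any orientation works. *)
Lemma balanced_orientation {E V : finType} (D : {set E}) (a b : E -> V) :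
  exists s : E -> bool,
    forall v, `|\sum_(e in D) (-1) ^+ s e * boundary a b e v| <= 1.
Proof.
have [n leDn] := ubnP #|D|; elim: n => // n IHn in D a b leDn *.
case: (boolP [exists v, exists e in D, exists f in D,
  [&& e != f, boundary a b e v != 0 & boundary a b f v != 0]]).
  case/existsP=> v /'exists_andP[e [eD /'exists_andP[f [fD /and3P[nef ev fv]]]]].
  have [se [p ep]] := boundary_at a b e v ev.
  have [sf [q fq]] := boundary_at a b f v fv.
  pose a' x := if x == f then p else a x.
  pose b' x := if x == f then q else b x.
  have [|s sP] := IHn (D :\ e) a' b'.
    by rewrite (cardsD1 e) eD in leDn.
  have fDe : f \in D :\ e by rewrite !inE eq_sym nef.
  (* The edge f stands for pq in the smaller graph. The signs se and sf record
     whether e and f are directed away from v, so that the boundaries of e and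
     f with the chosen signs add up to that of pq. *)
  exists (fun x => if x == e then ~~ (s f (+) se)
          else if x == f then s f (+) sf else s x) => u.
  have := sP u; congr (`|_| <= _).
  rewrite (big_setD1 e eD) /= eqxx !(big_setD1 f fDe) /= eqxx.
  rewrite eq_sym (negPf nef) addrA; congr (_ + _).
    rewrite ep fq /boundary /a' /b' eqxx.
    by case: (s f); case: se {ep}; case: sf {fq} => /=; rewrite ?expr0 ?expr1; ring.
  apply: eq_bigr => x; rewrite !inE => /and3P[/negPf xf /negPf xe _].
  by rewrite xf xe /boundary /a' /b' xf.
move=> noD; exists (fun=> false) => v.
under eq_bigr do rewrite mul1r.
case: (boolP [exists e in D, boundary a b e v != 0]) => [|no].
  case/'exists_andP=> e [eD ev]; rewrite (big_setD1 e eD) /= big1 => [|f].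
    by rewrite addr0 /boundary; case: eqP; case: eqP.
  rewrite !inE => /andP[nfe fD]; apply/eqP; apply: contraNT noD => fv.
  apply/existsP; exists v; apply/'exists_andP; exists e; split=> //.
  by apply/'exists_andP; exists f; split=> //; rewrite eq_sym nfe ev.
rewrite big1 ?normr0 // => e eD; apply/eqP; apply: contraNT no => ev.
by apply/'exists_andP; exists e.
Qed.

(** * List edge colouring of bipartite multigraphs *)

Local Open Scope nat_scope.

Lemma sum_squares_balanced (x y x' y' : nat) :
  x + y = x' + y' -> (x' <= y'.+1) -> (y' <= x'.+1) ->
  (x' ^ 2 + y' ^ 2 <= x ^ 2 + y ^ 2) /\
  (x.+1 < y -> x' ^ 2 + y' ^ 2 < x ^ 2 + y ^ 2).
Proof.
move=> eq le1 le2; split=> [|lt].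
  have [?|?] := leqP x y; nia.
nia.
Qed.

(** Koenig's theorem for the bipartite multigraph whose edge e joins p e to
    q e. Among all colourings with k colours, take one that minimizes the sum
    of the squares of the numbers n u c of edges of colour c at u. If these
    numbers differed by 2 or more for colours a and b at some vertex, a
    balanced orientation of the edges of colours a and b would give a better
    colouring: recolour by direction, which in a bipartite graph makes the two
    colours balanced at every vertex. So the colouring is equitable, and as
    no degree exceeds k, no colour occurs twice at a vertex. *)
Lemma bipartite_edge_colouring {E V W : finType} (p : E -> V) (q : E -> W) (k : nat) :
  (forall v, #|[set e | p e == v]| <= k) ->
  (forall v, #|[set e | q e == v]| <= k) ->
  exists r : E -> 'I_k,
    (forall e f, p e = p f -> r e = r f -> e = f) /\
    (forall e f, q e = q f -> r e = r f -> e = f).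
Proof.
move=> pk qk; case: k => [|k] in pk qk *.
  have noE (e : E) : False.
    by have := pk (p e); rewrite leqn0 cards_eq0 => /eqP/setP/(_ e); rewrite !inE eqxx.
  by exists (fun e => False_rect _ (noE e)); split=> e; case: (noE e).
pose inc e (u : V + W) := (inl (p e) == u) || (inr (q e) == u).
have inck u : #|[set e | inc e u]| <= k.+1.
  by case: u => [v|w]; [apply: leq_trans (pk v) | apply: leq_trans (qk w)];
    apply: subset_leq_card; apply/subsetP => e; rewrite !inE /inc ?orbF.
pose n (r : {ffun E -> 'I_k.+1}) u c := #|[set e | inc e u & r e == c]|.
pose phi r := \sum_u \sum_c n r u c ^ 2.
pose r := [arg min_(r < [ffun=> ord0]) phi r].
have rmin r' : phi r <= phi r' by rewrite /r; case: arg_minnP => // r0 _; apply.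
have equi u a b : n r u b <= (n r u a).+1.
  rewrite leqNgt; apply/negP => ltab.
  have nab : a != b by apply: contraTneq ltab => ->; rewrite -leqNgt; lia.
  pose D := [set e | (r e == a) || (r e == b)].
  have [s sP] := balanced_orientation D (fun e => inl (p e) : V + W)%type
                   (fun e => inr (q e) : V + W)%type.
  pose r' := [ffun e => if e \in D then if s e then a else b else r e].
  have nE r1 t c : n r1 t c = \sum_e (inc e t && (r1 e == c)).
    by rewrite /n -sum1_card big_mkcond /=; apply: eq_bigr => e _; rewrite inE; case: ifP.
  have other t c : c != a -> c != b -> n r' t c = n r t c.
    move=> /negPf ca /negPf cb; apply: eq_card => e; rewrite !inE ffunE inE.
    congr (_ && _).
    have [->|_] /= := eqVneq (r e) a; first by case: ifP => _; rewrite eq_sym ?ca ?cb // eq_sym ca.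
    by have [->|_] //= := eqVneq (r e) b; case: ifP => _; rewrite eq_sym ?ca ?cb // eq_sym cb.
  have tot t : n r t a + n r t b = n r' t a + n r' t b.
    rewrite !nE -!big_split /=; apply: eq_bigr => e _; rewrite ffunE inE.
    case: (inc e t) => //=.
    have [->|/negPf ra] /= := eqVneq (r e) a.
      by rewrite (negPf nab); case: (s e); rewrite ?eqxx ?(negPf nab) // eq_sym (negPf nab).
    have [_|rb] /= := eqVneq (r e) b; last by rewrite ra (negPf rb).
    by case: (s e); rewrite ?eqxx ?(negPf nab) // eq_sym (negPf nab).
  have bal t : (n r' t a <= (n r' t b).+1) /\ (n r' t b <= (n r' t a).+1).
    (* All edges at t leave it along p, or all enter it along q, hence up to
       sign the boundary sum at t is the difference of the two counts. *)
    have : (`|(n r' t b)%:Z - (n r' t a)%:Z| <= 1)%R.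
      have := sP t; rewrite (_ : (\sum_(e in D) _)%R =
         if t is inl _ then ((n r' t b)%:Z - (n r' t a)%:Z)%R else
         ((n r' t a)%:Z - (n r' t b)%:Z)%R); first by case: t => // w; rewrite distrC.
      rewrite !nE !(big_morph Posz PoszD (erefl 0%Z)) -!sumrB big_mkcond /=.
      case: t => t; apply: eq_bigr => e _; rewrite ffunE inE /inc /boundary /=.
        rewrite !orbF; have -> : (inl (p e) == inl t :> V + W) = (p e == t) by [].
        case: (p e == t); rewrite /= ?subr0 ?mulr0 ?mulr1 ?if_same //.
        have [ra|/negPf ra] /= := eqVneq (r e) a;
          have [rb|/negPf rb] /= := eqVneq (r e) b; rewrite ?ra ?rb //;
          case: (s e); rewrite ?eqxx ?(negPf nab) // eq_sym (negPf nab) //.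
      have -> : (inr (q e) == inr t :> V + W) = (q e == t) by [].
      case: (q e == t); rewrite /= ?subr0 ?mulr0 ?mulr1 ?if_same //.
      have [ra|/negPf ra] /= := eqVneq (r e) a;
        have [rb|/negPf rb] /= := eqVneq (r e) b; rewrite ?ra ?rb //;
        case: (s e); rewrite ?eqxx ?(negPf nab) // eq_sym (negPf nab) //.
    lia.
  have nba : b != a by rewrite eq_sym.
  have phit r1 t : \sum_c n r1 t c ^ 2 =
    n r1 t a ^ 2 + n r1 t b ^ 2 + \sum_(c | (c != a) && (c != b)) n r1 t c ^ 2.
    by rewrite (bigD1 a) //= (bigD1 b) //= addnA.
  have oth t : \sum_(c | (c != a) && (c != b)) n r' t c ^ 2 =
               \sum_(c | (c != a) && (c != b)) n r t c ^ 2.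
    by apply: eq_bigr => c /andP[ca cb]; rewrite other.
  have := rmin r'; rewrite leqNgt => /negP; apply.
  rewrite /phi (bigD1 u) //= [ltnRHS](bigD1 u) //= -addSn leq_add //.
    rewrite !phit oth -addSn leq_add2r.
    by have [b1 b2] := bal u; case: (sum_squares_balanced _ _ _ _ (tot u) b1 b2) => _; apply.
  apply: leq_sum => t _; rewrite !phit oth leq_add2r.
  by have [b1 b2] := bal t; case: (sum_squares_balanced _ _ _ _ (tot t) b1 b2).
have inj u e f : inc e u -> inc f u -> r e = r f -> e = f.
  move=> eu fu ref; apply/eqP; apply: contraTT isT => nef.
  have ge2 : 2 <= n r u (r e).
    rewrite (_ : 2 = #|[set e; f]|); last by rewrite cards2 nef.
    apply: subset_leq_card; apply/subsetP => x; rewrite !inE => /orP[]/eqP->.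
      by rewrite eu eqxx.
    by rewrite fu ref eqxx.
  (* The colour of e and f occurs twice at u, so all others occur at least
     once, which makes more than k edges. *)
  have ge1 c : 1 <= n r u c by have := equi u c (r e); lia.
  have : \sum_c n r u c <= k.+1.
    apply: leq_trans (inck u); rewrite -sum1_card (partition_big r xpredT) //=.
    by apply: leq_sum => c _; rewrite /n -sum1_card leq_eqVlt; apply/orP; left;
      apply/eqP; apply: eq_bigl => x; rewrite !inE.
  rewrite (bigD1 (r e)) //= leqNgt.
  suff -> : k.+1 < n r u (r e) + \sum_(c | c != r e) n r u c by [].
  have -> : k.+2 = 2 + \sum_(c < k.+1 | c != r e) 1.
    rewrite sum1_card cardC1 card_ord; lia.
  by apply: leq_add => //; apply: leq_sum.
exists r; split=> e f pe; first apply: (inj (inl (p e))); last apply: (inj (inr (q e)));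
  by rewrite /inc -?pe eqxx ?orbT.
Qed.

(** A stable matching: each p-vertex prefers edges of high rank, each q-vertex
    edges of low rank, and every edge outside M meets an edge of M that is
    preferred at a common end. If the favourite edges of the p-vertices form a
    matching, it is stable. Otherwise two favourites e and f meet at a
    q-vertex that prefers f. Then e can be discarded: since f is a favourite,
    whatever prevents f from being in M does so at that q-vertex, and is
    preferred to e there as well. *)
Lemma kernel_exists {E : finType} {V W : eqType} (p : E -> V) (q : E -> W)
    (r : E -> nat) (S : {set E}) :
  (forall e f, p e = p f -> r e = r f -> e = f) ->
  (forall e f, q e = q f -> r e = r f -> e = f) ->
  exists M : {set E}, [/\ M \subset S,
    {in M &, injective p}, {in M &, injective q} &
    forall e, e \in S -> e \notin M -> exists2 f, f \in M &
      (p f = p e /\ r e < r f) \/ (q f = q e /\ r f < r e)].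
Proof.
move=> pr qr; have [n leSn] := ubnP #|S|; elim: n => // n IHn in S leSn *.
pose top e := [forall f in S, (p f == p e) ==> (r f <= r e)].
have topP e f : top e -> f \in S -> p f = p e -> r f <= r e.
  by move=> /'forall_implyP te fS /eqP pf; apply: (implyP (te f fS)).
case: (boolP [exists e in S, exists f in S,
  [&& top e, top f, q f == q e & r f < r e]]).
  case/'exists_andP=> e [eS] /'exists_andP[f [fS /and4P[te tf /eqP qfe rfe]]].
  have [|M [/subsetP MS pM qM Mdom]] := IHn (S :\ e).
    by rewrite (cardsD1 e) eS in leSn.
  exists M; split=> //.
    by apply/subsetP => x /MS; rewrite !inE => /andP[].
  move=> x xS xM; have [->|nxe] := eqVneq x e; last first.
    by apply: Mdom => //; rewrite !inE nxe.
  have [fM|fM] := boolP (f \in M); first by exists f => //; right.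
  have fSe : f \in S :\ e.
    by rewrite !inE fS andbT; apply: contraTneq rfe => ->; rewrite ltnn.
  have [g gM [[pg]|[qg rg]]] := Mdom f fSe fM; last first.
    by exists g => //; right; rewrite qg; split=> //; apply: ltn_trans rfe.
  have := MS g gM; rewrite !inE => /andP[_ gS].
  by rewrite ltnNge topP.
move=> noS; exists [set e in S | top e].
have sameP e f : e \in S -> f \in S -> top e -> top f -> p e = p f -> e = f.
  move=> eS fS te tf pef; apply: (pr) => //; apply/eqP.
  by rewrite eqn_leq topP // topP.
split.
- by apply/subsetP => e; rewrite inE => /andP[].
- by move=> e f; rewrite !inE => /andP[eS te] /andP[fS tf]; apply: sameP.
- move=> e f; rewrite !inE => /andP[eS te] /andP[fS tf] qef.
  apply: (qr) => //; apply/eqP; apply: contraNT noS; rewrite neq_ltn.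
  by case/orP=> ref; apply/'exists_andP;
    [exists f | exists e]; split=> //; apply/'exists_andP;
    [exists e | exists f]; split=> //; rewrite te tf qef eqxx.
move=> e eS; rewrite inE eS /= => nte.
have pee : (e \in S) && (p e == p e) by rewrite eS eqxx.
pose f := [arg max_(f > e | (f \in S) && (p f == p e)) r f].
have [fS pf tf] : [/\ f \in S, p f = p e & top f].
  rewrite /f; case: arg_maxnP => // g /andP[gS /eqP pg] gmax.
  split=> //; apply/'forall_implyP => h hS; apply/implyP => /eqP ph.
  by apply: gmax; rewrite hS ph pg eqxx.
exists f; first by rewrite inE fS.
left; split=> //; rewrite ltn_neqAle topP // andbT.
by apply: contraNneq nte => re; rewrite (pr e f).
Qed.

(** The kernel method of Bondy, Boppana and Siegel. Give a colour c to a kernel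
    of the edges whose lists contain c, then delete those edges and the colour.
    An edge that loses c from its list was dominated by an edge of the kernel,
    so the number of edges dominating it drops as well. *)
Lemma list_colouring_from_ranking {E : finType} {V W : eqType} {C : finType}
    (p : E -> V) (q : E -> W) (r : E -> nat) (c0 : C) (S : {set E})
    (L : E -> {set C}) :
  (forall e f, p e = p f -> r e = r f -> e = f) ->
  (forall e f, q e = q f -> r e = r f -> e = f) ->
  (forall e, e \in S ->
    #|[set f in S | (p f == p e) && (r e < r f) ||
                    (q f == q e) && (r f < r e)]| < #|L e|) ->
  exists w : E -> C, [/\ forall e, e \in S -> w e \in L e,
    {in S &, forall e f, p e = p f -> w e = w f -> e = f} &
    {in S &, forall e f, q e = q f -> w e = w f -> e = f}].
Proof.
move=> pr qr; have [n leSn] := ubnP #|S|; elim: n => // n IHn in S L leSn *.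
move=> ltL; have [->|[e0 e0S]] := set_0Vmem S.
  by exists (fun=> c0); split=> [e|e|e]; rewrite inE.
have [c cL0] : exists c, c \in L e0.
  by apply/set0Pn; rewrite -card_gt0; apply: leq_ltn_trans (ltL _ e0S).
have [M [/subsetP MS pM qM Mdom]] :=
  kernel_exists p q r [set e in S | c \in L e] pr qr.
have MSc e : e \in M -> e \in S /\ c \in L e by move/MS; rewrite inE => /andP.
have [f0 f0M] : exists f, f \in M.
  have [?|nM] := boolP (e0 \in M); first by exists e0.
  by have [|f fM _] := Mdom e0 _ nM; [rewrite inE e0S | exists f].
have [|e|w [wL wp wq]] := IHn (S :\: M) (fun e => L e :\ c).
- rewrite ltnS in leSn; apply: leq_trans leSn; apply: proper_card.
  apply/properP; split; first exact: subsetDl.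
  by exists f0; [case: (MSc _ f0M) | rewrite inE f0M].
- rewrite inE => /andP[eM eS]; have := ltL e eS.
  set A := [set _ in S | _]; set B := [set _ in _ | _] => ltA.
  have BA : B \subset A.
    by apply/subsetP => f; rewrite !inE => /andP[/andP[_ ->]].
  have [cLe|cLe] := boolP (c \in L e); last first.
    rewrite (_ : L e :\ c = L e).
      exact: leq_ltn_trans (subset_leq_card BA) ltA.
    by apply/setDidPl; rewrite disjoint_sym disjoints1.
  have [|f fM fdom] := Mdom e _ eM; first by rewrite inE eS.
  rewrite (cardsD1 c) cLe in ltA; rewrite -ltnS; apply: leq_trans ltA; rewrite ltnS.
  apply: proper_card; apply/properP; split=> //; exists f; last first.
    by rewrite !inE fM.
  rewrite inE (proj1 (MSc f fM)) /=.
  by case: fdom => -[-> ->]; rewrite eqxx ?orbT.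
have wc e : e \in S -> e \notin M -> w e != c.
  by move=> eS eM; have := wL e; rewrite !inE eM eS => /(_ isT)/andP[].
exists (fun e => if e \in M then c else w e); split.
- move=> e eS; case: ifP => [/MSc[]//|/negbT eM].
  by have := wL e; rewrite !inE eM eS => /(_ isT)/andP[].
- move=> e f eS fS pef; case: ifPn => eM; case: ifPn => fM.
  + by move=> _; apply: pM.
  + by move=> /esym/eqP; rewrite (negPf (wc f _ _)).
  + by move=> /eqP; rewrite (negPf (wc e _ _)).
  + by apply: wp => //; rewrite inE ?eM ?fM.
- move=> e f eS fS pef; case: ifPn => eM; case: ifPn => fM.
  + by move=> _; apply: qM.
  + by move=> /esym/eqP; rewrite (negPf (wc f _ _)).
  + by move=> /eqP; rewrite (negPf (wc e _ _)).
  + by apply: wq => //; rewrite inE ?eM ?fM.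
Qed.

Lemma leq_card_injective {E : finType} (A : {set E}) (f : E -> nat) (m : nat) :
  {in A &, injective f} -> (forall e, e \in A -> f e < m) -> #|A| <= m.
Proof.
move=> injf fm; case: m fm => [|m] fm.
  by rewrite leqn0 cards_eq0; apply/eqP/setP => e; rewrite inE; apply/negP => /fm.
have fm' : {in A &, injective (fun e => inord (f e) : 'I_m.+1)}.
  move=> e e' eA e'A /(congr1 val); rewrite /= !inordK ?fm //; exact: injf.
by rewrite -(card_in_imset fm') -[leqRHS]card_ord max_card.
Qed.

(** Galvin's theorem. Rank the edges by a proper colouring r with k colours. An
    edge is dominated by at most k - 1 - r e edges at its p-end and at most
    r e edges at its q-end, that is by at most k - 1 edges in total. *)
Lemma bipartite_list_edge_colouring {E V W C : finType} (p : E -> V)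
    (q : E -> W) (k : nat) (L : E -> {set C}) :
  (forall v, #|[set e | p e == v]| <= k) ->
  (forall v, #|[set e | q e == v]| <= k) ->
  (forall e, k <= #|L e|) ->
  exists w : E -> C, [/\ forall e, w e \in L e,
    forall e f, p e = p f -> w e = w f -> e = f &
    forall e f, q e = q f -> w e = w f -> e = f].
Proof.
move=> pk qk kL; have [e0 _|noE] := pickP (@predT E); last first.
  have F (e : E) : False by have := noE e.
  by exists (fun e => False_rect _ (F e)); split=> e; case: (F e).
have [r [pr qr]] := bipartite_edge_colouring p q k pk qk.
have [c0 _] : exists c, c \in L e0.
  apply/set0Pn; rewrite -card_gt0; apply: leq_trans (kL e0).
  exact: leq_ltn_trans (leq0n _) (ltn_ord (r e0)).
have pr' e f : p e = p f -> r e = r f :> nat -> e = f.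
  by move=> pe /val_inj; apply: pr.
have qr' e f : q e = q f -> r e = r f :> nat -> e = f.
  by move=> qe /val_inj; apply: qr.
have [e _|w [wL wp wq]] :=
  list_colouring_from_ranking p q (fun e => r e) c0 setT L pr' qr'; last first.
  by exists w; split=> [e|e f|e f]; [apply: wL | apply: wp | apply: wq].
apply: leq_trans (kL e); have ltr := ltn_ord (r e).
apply: (@leq_ltn_trans (r e + (k.-1 - r e))); last by lia.
apply: leq_trans (subset_leq_card _) (leq_trans (leq_card_setU
  [set f | (q f == q e) && (r f < r e)] [set f | (p f == p e) && (r e < r f)]) _).
  by apply/subsetP => f; rewrite !inE orbC.
apply: leq_add.
  apply: (leq_card_injective _ (fun f => r f)) => [f g|f]; rewrite !inE.
    by move=> /andP[/eqP qf _] /andP[/eqP qg _]; apply: qr'; rewrite qf.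
  by case/andP.
apply: (leq_card_injective _ (fun f => r f - (r e).+1)) => [f g|f]; rewrite !inE.
  move=> /andP[/eqP pf lf] /andP[/eqP pg lg] rfg.
  by apply: pr'; [rewrite pf | lia].
by case/andP=> _; have := ltn_ord (r f); lia.
Qed.

(** Splitting each vertex into vertices of degree at most k, as few as
    possible; g numbers the parts of a vertex from 0. *)
Lemma split_fibres {E V : finType} (t : E -> V) (k : nat) : 0 < k ->
  exists g : E -> 'I_#|E|,
    (forall u, #|[set e | (t e, g e) == u]| <= k) /\
    (forall e, g e * k < #|[set f | t f == t e]|).
Proof.
move=> k_gt0; pose A e := [set f | t f == t e].
pose i e := index e (enum (A e)).
have i_lt e : i e < #|A e| by rewrite cardE index_mem mem_enum inE.
have g_lt e : i e %/ k < #|E|.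
  exact: leq_ltn_trans (leq_div _ _) (leq_trans (i_lt e) (max_card _)).
exists (fun e => Ordinal (g_lt e)); split=> [[v j]|e]; last first.
  by apply: leq_ltn_trans (leq_trunc_div _ _) (i_lt e).
apply: (leq_card_injective _ (fun e => i e %% k)) => [e f|e _]; last exact: ltn_pmod.
rewrite !inE !xpair_eqE -!val_eqE /= => /andP[/eqP te /eqP ge] /andP[/eqP tf /eqP gf] mef.
have : i e = i f by rewrite (divn_eq (i e) k) (divn_eq (i f) k) ge gf mef.
rewrite /i; have -> : A e = A f by rewrite /A te tf.
by apply: (index_inj e); rewrite mem_enum inE ?te ?tf.
Qed.

(** Galvin's theorem for the graph obtained by splitting: a colour occurs at
    most once at each part of a vertex of degree d, and there are
    ceil (d / k) parts. *)
Lemma bipartite_list_colouring_capacity {E V W C : finType} (p : E -> V)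
    (q : E -> W) (k : nat) (L : E -> {set C}) :
  0 < k -> (forall e, k <= #|L e|) ->
  exists w : E -> C, [/\ forall e, w e \in L e,
    forall v c, #|[set e | (p e == v) && (w e == c)]| * k
                < #|[set e | p e == v]| + k &
    forall v c, #|[set e | (q e == v) && (w e == c)]| * k
                < #|[set e | q e == v]| + k].
Proof.
move=> k_gt0 kL.
have [gp [gpk gplt]] := split_fibres p k k_gt0.
have [gq [gqk gqlt]] := split_fibres q k k_gt0.
have [w [wL wp wq]] := bipartite_list_edge_colouring _ _ k L gpk gqk kL.
have cap (U : finType) (t : E -> U) (g : E -> 'I_#|E|) v c :
    (forall e, g e * k < #|[set f | t f == t e]|) ->
    (forall e f, (t e, g e) = (t f, g f) -> w e = w f -> e = f) ->
  #|[set e | (t e == v) && (w e == c)]| * k < #|[set e | t e == v]| + k.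
  move=> glt winj; set d := #|[set e | t e == v]|.
  suff : #|[set e | (t e == v) && (w e == c)]| <= (d + k.-1) %/ k.
    by rewrite -(leq_pmul2r k_gt0) => /leq_trans/(_ (leq_trunc_div _ _)); lia.
  apply: (leq_card_injective _ (fun e => g e)) => [e f|e]; rewrite !inE.
    move=> /andP[/eqP te /eqP we] /andP[/eqP tf /eqP wf] /val_inj gef.
    by apply: winj; [rewrite te tf gef | rewrite we wf].
  by move=> /andP[/eqP te _]; rewrite leq_divRL //; have := glt e; rewrite te -/d; lia.
by exists w; split=> // v c; [apply: cap gplt wp | apply: cap gqlt wq].
Qed.

(** * Majority colourings *)

Local Open Scope ring_scope.

Lemma endpoints (G : sgraph) : exists a b : edge G -> G,
  forall x, a x != b x /\ forall v, incident v x = (a x == v) || (b x == v).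
Proof.
have ends (x : edge G) : exists ab : G * G,
    ab.1 != ab.2 /\ forall v, incident v x = (ab.1 == v) || (ab.2 == v).
  have /cards2P[a [b [nab xab]]] := introT eqP (card_edges (valP x)).
  exists (a, b); split=> // v; rewrite /incident xab !inE.
  by rewrite [v == a]eq_sym [v == b]eq_sym.
by have [f fP] := fin_all_exists ends; exists (fun x => (f x).1), (fun x => (f x).2).
Qed.

(** With outdegree P and indegree Q, balanced and of sum d(v) >= 4, the bound
    ceil (P / 3) + ceil (Q / 3) <= d(v) / 2 always holds, with
    equality for d(v) = 4 and d(v) = 8. *)
Lemma half_majority_colouring (G : sgraph) (C : finType) (L : edge G -> {set C}) :
  (forall v : G, 4 <= degree v)%N -> (forall x, 3 <= #|L x|)%N ->
  exists w : edge G -> C, (forall x, w x \in L x) /\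
    forall (v : G) c,
      (2 * #|[set x : edge G | incident v x & w x == c]| <= degree v)%N.
Proof.
move=> deg4 L3; have [a [b ab]] := endpoints G.
have [s sP] := balanced_orientation setT a b.
pose p x := if s x then b x else a x; pose q x := if s x then a x else b x.
have pq x : p x != q x /\ forall v, incident v x = (p x == v) || (q x == v).
  by have [n i] := ab x; rewrite /p /q; case: (s x); 
    (split=> [|v]; [rewrite // eq_sym | rewrite i // orbC]).
have [w [wL wp wq]] := bipartite_list_colouring_capacity p q 3 L isT L3.
exists w; split=> // v c.
have := wp v c; have := wq v c.
set P := #|[set e | p e == v]|; set Q := #|[set e | q e == v]|.
set Pc := #|_|; set Qc := #|_| => ltP ltQ.
have degE : degree v = (P + Q)%N.
  rewrite /degree /P /Q -cardsUI [X in (_ + X)%N](_ : _ = 0%N).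
    by rewrite addn0; apply: eq_card => x; rewrite !inE (pq x).2.
  apply/eqP; rewrite cards_eq0; apply/eqP/setP => x; rewrite !inE.
  by apply/negP => /andP[/eqP pv /eqP qv]; have := (pq x).1; rewrite pv qv eqxx.
have cntE : (#|[set x : edge G | incident v x & w x == c]| <= Qc + Pc)%N.
  apply: leq_trans (leq_card_setU _ _); apply: subset_leq_card.
  by apply/subsetP => x; rewrite !inE (pq x).2 -andb_orl.
have bal : `|P%:Z - Q%:Z| <= 1.
  have cE (A : {set edge G}) : #|A|%:Z = \sum_x (x \in A)%:R.
    by rewrite -sum1_card big_mkcond (big_morph Posz PoszD (erefl 0%Z)) /=;
      apply: eq_bigr => x _; case: (x \in A).
  have := sP v; rewrite /P /Q !cE -sumrB; congr (`|_| <= _).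
  rewrite (eq_bigl xpredT) => [|x]; last by rewrite inE.
  apply: eq_bigr => x _; rewrite !inE /boundary /p /q.
  by case: (s x); rewrite ?mul1r // expr1 mulN1r opprB.
have := deg4 v; lia.
Qed.

(** The blocks are the edges, and the constraints are the pairs of a vertex and
    a colour. A weight y x c occurs in the constraints of the two ends of x, so
    the rounding error is 2 * 2. *)
Lemma rounded_colouring {R : realFieldType} (G : sgraph) (C : finType)
    (y : edge G -> C -> R) :
  (forall x c, 0 <= y x c) -> (forall x, \sum_c y x c = 1) ->
  exists w : edge G -> C, (forall x, y x (w x) != 0) /\
    forall (v : G) c, #|[set x : edge G | incident v x & w x == c]|%:R
      <= \sum_(x | incident v x) y x c + 4.
Proof.
move=> y0 y1; have [a [b ab]] := endpoints G.
pose inc (i : edge G * C) := [set (a i.1, i.2); (b i.1, i.2)].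
have incE v c i : ((v, c) \in inc i) = incident v i.1 && (c == i.2).
  by rewrite !inE !xpair_eqE -andb_orl (ab i.1).2 ![v == _]eq_sym.
have [i|i|x|w [w1 w0 wle]] :=
    iterated_rounding (fun i : edge G * C => i.1) inc 2 (fun i => y i.1 i.2).
- by rewrite cards2; case: (_ != _).
- exact: y0.
- transitivity (\sum_(z | z == x) \sum_c y z c); last by rewrite big_pred1_eq.
  by rewrite pair_big_dep /=; apply: eq_bigl => i; rewrite andbT.
exists (fun x => (w x).2); split=> [x|v c]; first by have := w0 x; rewrite w1.
have := wle (v, c); rewrite (eq_bigl (fun i => incident v i.1 && (c == i.2))) => [|i];
  last exact: incE.
rewrite -(pair_big_dep (fun x => incident v x) (fun _ c' => c == c') y) /=.
under eq_bigr do rewrite (big_pred1 c) //=; move=> le; apply: le_trans le.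
rewrite ler_nat; apply: subset_leq_card; apply/subsetP => x.
by rewrite in_set in_set incE w1 [c == _]eq_sym.
Qed.

(** The combinatorial core, for finitely many colours: the hypothesis on the
    positive parts is what excess becomes after subtracting 1/k from each
    tolerance. *)
Lemma majority_colouring_of_positive_parts {R : realFieldType} (G : sgraph) (C : finType)
    (alpha : C -> R) (L : edge G -> {set C}) (k : nat) :
  (2 <= k)%N -> (forall c, 0 < alpha c < 1) ->
  (forall v : G, (2 * k * k.-1) <= degree v)%N ->
  (forall x, 1 <= \sum_(c in L x) Num.max 0 (alpha c - k%:R^-1)) ->
  exists w : edge G -> C, (forall x, w x \in L x) /\
    forall (v : G) c, #|[set x : edge G | incident v x & w x == c]|%:R
      <= alpha c * (degree v)%:R.
Proof.
move=> k2 alpha01 deg sum1.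
have [k3|] := leqP 3 k; last first.
  move=> k3; have k2E : k = 2 by apply/eqP; rewrite eqn_leq k2 andbT.
  rewrite {k k2 k3}k2E in deg sum1.
  pose large := [set c | 2%:R^-1 < alpha c].
  have [v|x|w [wL wmaj]] := half_majority_colouring G C (fun x => L x :&: large).
  - exact: deg.
  (* Each of the large colours contributes less than 1/2 to a sum that is at
     least 1, so there are at least three of them. *)
  - rewrite ltnNge; apply/negP => le2; have := sum1 x.
    have big0 c : c \notin large -> Num.max 0 (alpha c - 2%:R^-1) = 0.
      by rewrite inE -leNgt => h; apply/max_idPl; rewrite subr_le0.
    rewrite (big_setID large) /= [X in _ + X]big1 => [|c]; last first.
      by rewrite inE => /andP[/big0].
    rewrite addr0 => ge1; have [A0|[c cA]] := set_0Vmem (L x :&: large).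
      by move: ge1; rewrite A0 big_set0 ler10.
    have : \sum_(c in L x :&: large) Num.max 0 (alpha c - 2%:R^-1) <
           \sum_(c in L x :&: large) 2%:R^-1 :> R.
      apply: ltr_sum => [|d _]; first by apply/hasP; exists c; rewrite ?mem_index_enum.
      rewrite gt_max invr_gt0 ltr0n /=; have /andP[_ ?] := alpha01 d; lra.
    rewrite sumr_const => lt; have := le_lt_trans ge1 lt.
    have : #|L x :&: large|%:R <= 2%:R :> R by rewrite ler_nat.
    by rewrite -mulr_natr; lra.
  exists w; split=> [x|v c]; first by have := wL x; rewrite inE => /andP[].
  case: (boolP [exists x, w x == c]) => [/existsP[x /eqP xc]|/existsPn no]; last first.
    rewrite (_ : [set _ | _] = set0) ?cards0.
      by rewrite mulr_ge0 // ltW //; have /andP[] := alpha01 c.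
    by apply/setP => x; rewrite !inE (negPf (no x)) andbF.
  have := wL x; rewrite !inE xc => /andP[_ c2].
  have := wmaj v c; rewrite -(ler_nat R) natrM => le.
  have := ler_wpM2r (ler0n R (degree v)) (ltW c2); lra.
pose beta c := Num.max 0 (alpha c - k%:R^-1).
have beta0 c : 0 <= beta c by rewrite le_max lexx.
pose S x := \sum_(c in L x) beta c.
have S1 x : 1 <= S x by apply: sum1.
have S0 x : 0 < S x by apply: lt_le_trans (S1 x).
pose y x c := if c \in L x then beta c / S x else 0.
have y0 x c : 0 <= y x c.
  by rewrite /y; case: ifP => // _; rewrite divr_ge0 // ltW.
have yb x c : y x c <= beta c.
  by rewrite /y; case: ifP => // _; rewrite ler_pdivrMr // ler_peMr.
have [x|w [wy wle]] := rounded_colouring G C y y0.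
  by rewrite /y -big_mkcond /= -mulr_suml divff // gt_eqF // S0.
have wL x : w x \in L x by have := wy x; rewrite /y; case: ifP; rewrite ?eqxx.
have wb x : beta (w x) != 0.
  by have := wy x; rewrite /y wL; apply: contraNneq => ->; rewrite mul0r.
exists w; split=> // v c.
have [b0|b0] := eqVneq (beta c) 0.
  rewrite (_ : [set _ | _] = set0) ?cards0.
    by rewrite mulr_ge0 // ltW //; have /andP[] := alpha01 c.
  apply/setP => x; rewrite !inE; apply/negP => /andP[_ /eqP xc].
  by have := wb x; rewrite xc b0 eqxx.
have bE : beta c = alpha c - k%:R^-1.
  by move: b0; rewrite /beta; case: (leP 0 (alpha c - k%:R^-1)); rewrite ?eqxx.
have k0 : 0 < k%:R :> R by rewrite ltr0n; lia.
have dk : 4 <= k%:R^-1 * (degree v)%:R :> R.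
  rewrite -[4]mul1r -ler_pdivrMl ?invr_gt0 // invrK mul1r mulrC -natrM ler_nat.
  by apply: leq_trans (deg v); nia.
apply: le_trans (wle v c) _.
apply: (@le_trans _ _ (beta c * (degree v)%:R + 4)).
  rewrite lerD2r mulr_natr -sumr_const [leRHS](eq_bigl (fun x => incident v x)) => [|x].
    by apply: ler_sum.
  by rewrite inE.
by rewrite bE mulrBl; lra.
Qed.

(** * Arbitrary colour sets *)

From mathcomp Require Import finmap boolp classical_sets cardinality fsbigop.
From mathcomp Require Import reals ereal esum.

Lemma min_degree_le (G : sgraph) (v : G) : (min_degree G <= degree v)%N.
Proof.
rewrite /min_degree; elim: (index_enum G) (mem_index_enum v) => // u s IHs.
rewrite inE big_cons => /predU1P[->|/IHs]; first exact: geq_minl.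
by apply: leq_trans; apply: geq_minr.
Qed.

Lemma sum_of_excessive_list {R : realType} (G : sgraph) (C : choiceType)
    (eps : R) (alpha : C -> R) (L : edge G -> set C) (x : edge G) :
  tolerance alpha -> excessive eps alpha L -> finite_set (L x) ->
  1 + eps <= \sum_(c <- fset_set (L x)) alpha c.
Proof.
move=> tol exc fin; have := exc x.
rewrite esum_fset // => [|c _]; last by rewrite lee_fin; case/andP: (tol c) => /ltW.
by rewrite fsbig_finite // sumEFin lee_fin.
Qed.

(** The finitely many finite lists use only finitely many colours, and these
    form a finite type P to which the lists can be transported. *)
Lemma finite_palette {C : choiceType} {R : Type} {I : finType} (idx : R)
   (op : Monoid.com_law idx) (A : I -> {fset C}) :
  exists P : {fset C}, forall (i : I) (f : C -> R),
    \big[op/idx]_(c : P | \val c \in A i) f (\val c) = \big[op/idx]_(c <- A i) f c.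
Proof.
exists (\bigcup_(i <- enum I) A i)%fset => i f.
rewrite -(big_seq_fsetE op _ (fun c => c \in A i)) -big_filter.
apply/perm_big/uniq_perm; rewrite ?filter_uniq ?fset_uniq // => c.
rewrite mem_filter andb_idr // => cA.
by apply/bigfcupP; exists i; rewrite ?mem_enum.
Qed.

Lemma majority_colouring_exists (R : realType) (l : nat) (eps : R) :
  0 < eps -> sufficient_min_degree l eps
    (2 * Num.ceil (l%:R / eps) ^+ 2 - 2 * Num.ceil (l%:R / eps)).
Proof.
move=> eps0 G dmin C alpha tol L exc sz.
have [x0 _|noE] := pickP (@predT (edge G)); last first.
  have F (x : edge G) : False by have := noE x.
  exists (fun x => False_rect _ (F x)); split=> [x|v c]; first by case: (F x).
  rewrite (_ : finset _ = finset.set0) ?cards0.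
    by rewrite mulr_ge0 // ltW //; case/andP: (tol c).
  by apply/setP => x; case: (F x).
have fin x : finite_set (L x) by apply/finite_set_leP; exists l; apply: sz.
have cardL x : (#|` fset_set (L x)| <= l)%N by apply: geq_card_fset_set.
have sumL x := sum_of_excessive_list G C eps alpha L x tol exc (fin x).
have := ceil_ge (l%:R / eps); set K := Num.ceil _ in dmin * => leK.
have K0 : 0 <= K by rewrite -(ler0z R); apply: le_trans leK; rewrite divr_ge0 // ltW.
case: K K0 leK dmin => // k _ leK dmin.
have lek : l%:R <= k%:R * eps by rewrite -ler_pdivrMr.
(* If k <= 1, then l <= eps; but the l or fewer tolerances of a list, each
   below 1, sum to at least 1 + eps. *)
have k2 : (2 <= k)%N.
  rewrite ltnNge; apply/negP => k1.
  have kR : k%:R <= 1 :> R by rewrite (ler_nat R k 1).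
  have keps : k%:R * eps <= 1 * eps by rewrite ler_pM2r.
  have : \sum_(c <- fset_set (L x0)) alpha c <= l%:R.
    apply: (@le_trans _ _ (\sum_(c <- fset_set (L x0)) 1)).
      by apply: ler_sum => c _; apply: ltW; case/andP: (tol c).
    by rewrite big_const_seq count_predT iter_addr_0 ler_nat.
  by have := sumL x0; lra.
have k0 : 0 < k%:R :> R by rewrite ltr0n; lia.
have [P PE] := finite_palette 0 (+%R : Monoid.com_law (0 : R)) (fun x => fset_set (L x)).
pose L' x := finset (fun c : P => val c \in fset_set (L x)).
have [|v|x|w [wL wmaj]] := majority_colouring_of_positive_parts G P
    (fun c => alpha (val c)) L' k k2.
- by move=> c; apply: tol.
- apply: leq_trans (min_degree_le G v).
  have [j kE] : exists j, k = j.+1 by exists k.-1; lia.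
  by move: dmin; rewrite kE expr2; nia.
- rewrite (eq_bigl (fun c : P => val c \in fset_set (L x))) => [|c]; last by rewrite inE.
  rewrite (PE x (fun c => Num.max 0 (alpha c - k%:R^-1))).
  apply: (@le_trans _ _ (\sum_(c <- fset_set (L x)) (alpha c - k%:R^-1))); last first.
    by apply: ler_sum => c _; rewrite le_max lexx orbT.
  rewrite sumrB big_const_seq count_predT iter_addr_0 -mulr_natl.
  have : (size (fset_set (L x)))%:R / k%:R <= l%:R / k%:R :> R.
    by rewrite ler_pM2r ?invr_gt0 // ler_nat.
  have : l%:R / k%:R <= eps by rewrite ler_pdivrMr // mulrC.
  by have := sumL x; lra.
exists (fun x => val (w x)); split=> [x|v c].
  have := wL x; rewrite inE in_fset_set // => /set_mem; exact.
have [cP|cP] := boolP (c \in P).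
  apply: le_trans (wmaj v [` cP]%fset); rewrite ler_nat.
  by apply: subset_leq_card; apply/fintype.subsetP => x; rewrite !inE.
rewrite (_ : finset _ = finset.set0) ?cards0.
  by rewrite mulr_ge0 // ltW //; case/andP: (tol c).
apply/setP => x; rewrite !inE; apply/negP => /andP[_ /eqP xc].
by move: cP; rewrite -xc fsvalP.
Qed.

Theorem theorem16 (R : realType) (l : nat) (eps : R)
    (hl : (2 <= l)%N) (heps : 0 < eps) :
  (exists d0 : int, sufficient_min_degree l eps d0) /\
  sufficient_min_degree l eps
    (2 * Num.ceil (l%:R / eps) ^+ 2 - 2 * Num.ceil (l%:R / eps)).
Proof.
have bound := majority_colouring_exists R l eps heps.
by split=> //; exists (2 * Num.ceil (l%:R / eps) ^+ 2 - 2 * Num.ceil (l%:R / eps)).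
Qed.
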